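(* Let $(X,d)$ be a compact metric space and let $f_{1,\infty}=\{f_n:X\to X\}_{n=1}^{\infty}$ be a nonautonomous discrete dynamical system on $X$, i.e. a sequence of continuous self-maps of $X$, with $h_{\mathrm{top}}(f_{1,\infty})<+\infty$. Then there exists an upper semi-continuous function $\mathfrak{h}_{f_{1,\infty}}:\mathcal{P}(X)\to\mathbb{R}$ such that $$P_{\mathrm{top}}(f_{1,\infty},\varphi)=\max_{\mu\in\mathcal{P}(X)}\left\{\mathfrak{h}_{f_{1,\infty}}(\mu)+\int_X\varphi\,d\mu\right\}\qquad\forall\,\varphi\in C(X)$$ and $$\mathfrak{h}_{f_{1,\infty}}(\mu)=\inf_{\varphi\in C(X)}\left\{P_{\mathrm{top}}(f_{1,\infty},\varphi)-\int\varphi\,d\mu\right\}\qquad\forall\,\mu\in\mathcal{P}(X).$$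
   Context: $\mathcal{P}(X)$ is the space of Borel probability measures on $X$ with the weak$^*$ topology; $C(X)$ is the space of continuous functions $\varphi:X\to\mathbb{R}$ (potentials) with the supremum norm. Put $d_n(x,y)=\max\{d(f_i\circ f_{i-1}\circ\cdots\circ f_1(x),\,f_i\circ f_{i-1}\circ\cdots\circ f_1(y)):1\le i\le n-1\}$. For $\varepsilon>0$, a subset $E\subset X$ is $(n,\varepsilon)$-separated if $d_n(x,y)\ge\varepsilon$ for all distinct $x,y\in E$. For $\varphi\in C(X)$ let $$S_n^{f_{1,\infty}}\varphi(x)=\varphi(x)+\varphi(f_1(x))+\varphi(f_2\circ f_1(x))+\cdots+\varphi(f_{n-1}\circ\cdots\circ f_1(x)),$$ $$P_n(f_{1,\infty},\varphi,\varepsilon)=\sup_E\Big\{\sum_{x\in E}e^{S_n^{f_{1,\infty}}\varphi(x)}:E\text{ is an }(n,\varepsilon)\text{-separated subset of }X\Big\}.$$ The topological pressure is $$P_{\mathrm{top}}(f_{1,\infty},\varphi)=\lim_{\varepsilon\to0^+}\limsup_{n\to\infty}\frac1n\log P_n(f_{1,\infty},\varphi,\varepsilon).$$ The topological entropy is $h_{\mathrm{top}}(f_{1,\infty})=\lim_{\varepsilon\to0}\limsup_{n\to\infty}\frac1n\log s(n,\varepsilon,f_{1,\infty})$, where $s(n,\varepsilon,f_{1,\infty})$ is the maximal cardinality of an $(n,\varepsilon)$-separated subset of $X$; it equals $P_{\mathrm{top}}(f_{1,\infty},0)$.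
   Formalization: The function h takes values in [-∞,+∞) instead of ℝ, since the second formula can force -∞ (X={p,q}, all f_n constantly p, μ=δ_q gives inf(φ(p)-φ(q))=-∞); X is taken to be nonempty. *)

(* Defs.v *)
From HB Require Import structures.
From mathcomp Require Import all_boot all_order all_algebra.
From mathcomp Require Import all_classical all_reals all_analysis.
Import Order.TTheory GRing.Theory Num.Theory.
Import numFieldNormedType.Exports.

Set Implicit Arguments.
Unset Strict Implicit.
Unset Printing Implicit Defensive.

Local Open Scope classical_set_scope.
Local Open Scope ring_scope.

(* Nonempty metric spaces: measurable types have to be pointed. *)
#[short(type="pmetricType")]
HB.structure Definition PointedMetric (K : numDomainType) :=
  {M of Metric K M & Pointed M}.

Section Pressure.
Context {R : realType} {X : pmetricType R}.

(* The maps of the system are f 1, f 2, and so on; f 0 is never used.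
   [orbit_map f i] is the composite of f i, ..., f 1. *)
Fixpoint orbit_map (f : nat -> X -> X) (i : nat) (x : X) : X :=
  if i is j.+1 then f j.+1 (orbit_map f j x) else x.

(* The indices are 1, ..., n - 1, so the distance is 0 when n <= 1.  Adding the
   index 0 would not change the entropy or the pressure of a compact space: a
   set separated for the larger distance is covered by a number of sets
   separated for this one which does not depend on n. *)
Definition dyn_dist (f : nat -> X -> X) (n : nat) (x y : X) : R :=
  \big[Num.max/0]_(1 <= i < n) mdist (orbit_map f i x) (orbit_map f i y).

Definition separated (f : nat -> X -> X) (n : nat) (eps : R) (E : set X) : Prop :=
  forall x y, E x -> E y -> x != y -> eps <= dyn_dist f n x y.

Definition birkhoff_sum (f : nat -> X -> X) (phi : X -> R) (n : nat) (x : X) : R :=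
  \sum_(0 <= i < n) phi (orbit_map f i x).

Local Open Scope ereal_scope.

Definition pressure_n (f : nat -> X -> X) (phi : X -> R) (eps : R) (n : nat) :
    \bar R :=
  ereal_sup [set \esum_(x in E) (expR (birkhoff_sum f phi n x))%:E
            | E in [set E : set X | separated f n eps E]].

Definition Ptop (f : nat -> X -> X) (phi : X -> R) : \bar R :=
  lim (limn_esup (fun n => (n%:R^-1)%:E * lne (pressure_n f phi eps n))
       @[eps --> (0%R : R)^'+]).

Definition max_separated (f : nat -> X -> X) (eps : R) (n : nat) : \bar R :=
  ereal_sup [set counting E | E in [set E : set X | separated f n eps E]].

Definition htop (f : nat -> X -> X) : \bar R :=
  lim (limn_esup (fun n => (n%:R^-1)%:E * lne (max_separated f eps n))
       @[eps --> (0%R : R)^'+]).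

End Pressure.

Definition borel {R : realType} (X : pmetricType R) :=
  g_sigma_algebraType (@open X).

Definition borel_probability {R : realType} (X : pmetricType R) :=
  probability (borel X) R.

(* The type borel_probability X with the coarsest topology making
   mu |-> \int phi dmu continuous for every continuous phi. *)
Definition weak_star {R : realType} (X : pmetricType R) : topologicalType :=
  initial_topology
    ((fun (mu : probability (borel X) R) (phi : continuousType X R) =>
        \int[mu]_x phi x) :
     probability (borel X) R -> {ptws continuousType X R -> R}).

(* The dual of the library's lower_semicontinuous. *)
Definition upper_semicontinuous {R : realType} {T : topologicalType}
    (h : T -> \bar R) : Prop :=
  forall x (a : R), (h x < a%:E)%E ->
    exists2 V, nbhs x V & forall y, V y -> (h y < a%:E)%E.

(* Main.v *)
(** On bounded potentials, [phi |-> Ptop f phi] is finite (because [htop f] is),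
    monotone, convex (Hoelder) and commutes with adding constants.  By
    Hahn-Banach it has a supporting linear functional at every continuous
    [phi]; monotonicity and the behaviour on constants make this functional
    positive and normalised, so by Riesz-Markov it is integration against a
    Borel probability [mu].  The support inequality then says exactly that the
    infimum defining [h mu] is attained at [phi].  Upper semicontinuity of [h]
    is automatic for an infimum of weak-star continuous functions. *)

From HB Require Import structures.
Require Import Defs.
From mathcomp Require Import all_boot all_order all_algebra.
From mathcomp Require Import all_classical all_reals all_analysis.
From mathcomp Require Import ring lra.
Import Order.TTheory GRing.Theory Num.Theory.
Import numFieldNormedType.Exports.

Set Implicit Arguments.
Unset Strict Implicit.
Unset Printing Implicit Defensive.

Local Open Scope classical_set_scope.
Local Open Scope ring_scope.

(** * Hahn-Banach and subgradients of convex functions *)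

Section HahnBanach.
Context {R : realType} {V : lmodType R}.
Implicit Types (S : set V) (p q L : V -> R).

(** Subspaces are predicates on an ambient module, so that the continuous functions can be treated
    as a subset of all functions from [X] to [R]. *)
Definition subspace_set S :=
  S 0 /\ forall (a : R) x y, S x -> S y -> S (a *: x + y).

(** Only [<=] is asked for scaling; the reverse inequality follows by scaling back with [t^-1]. *)
Definition sublinear_on S q :=
  (forall x y, S x -> S y -> q (x + y) <= q x + q y) /\
  (forall (t : R) x, 0 < t -> S x -> q (t *: x) <= t * q x).

Definition convex_on S q :=
  forall (t : R) x y, 0 <= t -> t <= 1 -> S x -> S y ->
    q (t *: x + (1 - t) *: y) <= t * q x + (1 - t) * q y.

Definition linear_on S L :=
  forall (a : R) x y, S x -> S y -> L (a *: x + y) = a * L x + L y.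

Lemma subspaceD S x y : subspace_set S -> S x -> S y -> S (x + y).
Proof. by move=> [_ h] Sx Sy; rewrite -[x]scale1r; exact: h. Qed.

Lemma subspaceZ S a x : subspace_set S -> S x -> S (a *: x).
Proof. by move=> [S0 h] Sx; rewrite -[_ *: _]addr0; exact: h. Qed.

Lemma subspaceN S x : subspace_set S -> S x -> S (- x).
Proof. by move=> Ss Sx; rewrite -scaleN1r; exact: subspaceZ. Qed.

Lemma le_inf_add (A B : set R) (c : R) : A !=set0 -> B !=set0 ->
  (forall a b, A a -> B b -> c <= a + b) -> c <= inf A + inf B.
Proof.
move=> A0 B0 h; rewrite -lerBlDl; apply: lb_le_inf => // b Bb.
rewrite lerBlDl -lerBlDr; apply: lb_le_inf => // a Aa.
by rewrite lerBlDr; exact: h.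
Qed.

Lemma le_inf_mul (A : set R) (t c : R) : 0 < t -> A !=set0 ->
  (forall a, A a -> c <= t * a) -> c <= t * inf A.
Proof.
move=> t0 A0 h; rewrite mulrC -ler_pdivrMr//; apply: lb_le_inf => // a Aa.
by rewrite ler_pdivrMr// mulrC; exact: h.
Qed.

Lemma sublinear0 S q : subspace_set S -> sublinear_on S q -> q 0 = 0.
Proof.
move=> [S0 _] [qD qZ]; have := qD _ _ S0 S0; rewrite addr0.
have := qZ (2^-1) 0 ltac:(by []) S0; rewrite scaler0.
lra.
Qed.

Lemma sublinear_opp S q x : subspace_set S -> sublinear_on S q -> S x ->
  - q (- x) <= q x.
Proof.
move=> Ss qs Sx; have := qs.1 _ _ Sx (subspaceN Ss Sx).
by rewrite subrr (sublinear0 Ss qs) -lerBlDr sub0r.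
Qed.

(* A sublinear functional which is minimal for the pointwise order is linear, so
   Zorn's lemma replaces the usual extension of partial functionals. *)
Lemma minimal_sublinear S p : subspace_set S -> sublinear_on S p ->
  exists q, [/\ sublinear_on S q, forall x, S x -> q x <= p x &
    forall r, sublinear_on S r -> (forall x, S x -> r x <= q x) ->
      forall x, S x -> q x <= r x].
Proof.
move=> Ss ps.
pose P q := sublinear_on S q /\ forall x, S x -> q x <= p x.
pose T := {q | P q}.
(* The order is reversed: a maximal element in Zorn's lemma is a minimal functional, and a chain is
   bounded by its pointwise infimum. *)
pose leT (a b : T) := forall x, S x -> sval b x <= sval a x.
have pT : P p by [].
have [|||[q [qs qp]] qmin] :=
    @ZL_preorder T (exist P p pT) (fun a b => `[< leT a b >]).
- by move=> t; apply/asboolP => x _.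
- move=> a b c /asboolP ab /asboolP bc; apply/asboolP => x Sx.
  exact: le_trans (bc x Sx) (ab x Sx).
- move=> A Atot.
  have [A0|/nonemptyPn A0] := pselect (A !=set0); last first.
    by exists (exist P p pT) => s; rewrite A0.
  pose E x := [set sval a x | a in A].
  have E0 x : E x !=set0 by case: A0 => a Aa; exists (sval a x), a.
  have Elb x : S x -> has_lbound (E x).
    move=> Sx; exists (- p (- x)) => _ [a _ <-].
    case: a => a /= [as_ ap]; apply: le_trans (sublinear_opp Ss as_ Sx).
    by rewrite lerN2; apply: ap; exact: subspaceN.
  have ginf x a : S x -> A a -> inf (E x) <= sval a x.
    by move=> Sx Aa; apply: ge_inf; [exact: Elb|exists a].
  have infT : P (fun x => inf (E x)).
    split; last first.
      move=> x Sx; case: A0 => a Aa; apply: le_trans (ginf _ _ Sx Aa) _.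
      case: (a) => b /= [_]; exact.
    split.
      move=> x y Sx Sy; apply: le_inf_add => // _ _ [a Aa <-] [b Ab <-].
      (* One of two members of a chain lies below both, and its subadditivity bounds the infimum at
         [x + y]. *)
      have [c [Ac ca cb]] : exists c, [/\ A c, leT a c & leT b c].
        have [/asboolP ab|/asboolP ba] := Atot _ _ Aa Ab.
          by exists b; split => // z _.
        by exists a; split => // z _.
      apply: le_trans (ginf _ _ (subspaceD Ss Sx Sy) Ac) _.
      apply: le_trans (lerD (ca x Sx) (cb y Sy)).
      by case: (c) => d /= [[dD _] _]; exact: dD.
    move=> t x t0 Sx; apply: le_inf_mul => // _ [a Aa <-].
    apply: le_trans (ginf _ _ (subspaceZ t Ss Sx) Aa) _.
    by case: (a) => b /= [[_ bZ] _]; exact: bZ.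
  exists (exist P (fun x => inf (E x)) infT) => a Aa; apply/asboolP => x Sx /=.
  exact: ginf.
exists q; split => // r rs rq x Sx.
have rT : P r.
  by split => // y Sy; exact: le_trans (rq y Sy) (qp y Sy).
have /asboolP := qmin (exist P r rT) ltac:(by apply/asboolP).
exact.
Qed.

(** Minimality forces [q (- y) = - q y], and this oddness turns subadditivity and positive
    homogeneity into linearity. *)
Theorem hahn_banach S p : subspace_set S -> sublinear_on S p ->
  exists2 L, linear_on S L & forall x, S x -> L x <= p x.
Proof.
move=> Ss ps; have [q [qs qp qmin]] := minimal_sublinear Ss ps.
exists q => //.
have q0 := sublinear0 Ss qs.
have qZ (t : R) x : 0 <= t -> S x -> q (t *: x) = t * q x.
  rewrite le_eqVlt => /predU1P[<-|t0] Sx; first by rewrite scale0r mul0r.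
  apply/eqP; rewrite eq_le qs.2//= mulrC -ler_pdivlMr// mulrC.
  have := qs.2 t^-1 (t *: x) ltac:(by rewrite invr_gt0) (subspaceZ t Ss Sx).
  by rewrite scalerA mulVf ?gt_eqF// scale1r.
have qN y : S y -> q (- y) = - q y.
  move=> Sy; apply/eqP; rewrite eq_le [X in _ && X]lerNl.
  rewrite (sublinear_opp Ss qs Sy) andbT.
  (* [inf E] is sublinear and below [q], and at [- y] it is at most [- q y]. *)
  pose E x := [set q (x + t *: y) - t * q y | t in [set t : R | 0 <= t]].
  have E0 x : E x !=set0 by exists (q (x + 0 *: y) - 0 * q y), 0 => /=.
  have Elb x : S x -> has_lbound (E x).
    move=> Sx; exists (- q (- x)) => _ [t /= t0 <-].
    have Sxy : S (x + t *: y) by apply: subspaceD => //; exact: subspaceZ.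
    have := qs.1 _ _ Sxy (subspaceN Ss Sx).
    by rewrite addrAC subrr add0r qZ//; lra.
  have ginf x t : S x -> 0 <= t -> inf (E x) <= q (x + t *: y) - t * q y.
    by move=> Sx t0; apply: ge_inf; [exact: Elb|exists t].
  have rs : sublinear_on S (fun x => inf (E x)).
    split.
      move=> x x' Sx Sx'; apply: le_inf_add => // _ _ [t /= t0 <-] [s /= s0 <-].
      apply: le_trans (ginf _ (t + s) (subspaceD Ss Sx Sx') (addr_ge0 t0 s0)) _.
      have := qs.1 _ _ (subspaceD Ss Sx (subspaceZ t Ss Sy))
        (subspaceD Ss Sx' (subspaceZ s Ss Sy)).
      by rewrite addrACA -scalerDl; lra.
    move=> t x t0 Sx; apply: le_inf_mul => // _ [s /= s0 <-].
    apply: le_trans (ginf _ (t * s) (subspaceZ t Ss Sx) _) _.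
      by rewrite mulr_ge0// ltW.
    have Sxy : S (x + s *: y) by apply: subspaceD => //; exact: subspaceZ.
    by rewrite -scalerA -scalerDr (qZ _ _ (ltW t0) Sxy) mulrBr mulrA.
  have rq x : S x -> inf (E x) <= q x.
    move=> Sx; apply: le_trans (ginf x 0 Sx (lexx _)) _.
    by rewrite scale0r addr0 mul0r subr0.
  have SNy := subspaceN Ss Sy.
  apply: le_trans (qmin _ rs rq _ SNy) _.
  apply: le_trans (ginf _ 1 SNy ler01) _.
  by rewrite scale1r addNr q0 mul1r sub0r.
have qD x y : S x -> S y -> q (x + y) = q x + q y.
  move=> Sx Sy; apply/eqP; rewrite eq_le qs.1//=.
  have := qs.1 _ _ (subspaceD Ss Sx Sy) (subspaceN Ss Sy).
  by rewrite addrK qN//; lra.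
move=> a x y Sx Sy; rewrite qD//; last exact: subspaceZ.
congr (_ + _); have [a0|a0] := leP 0 a; first exact: qZ.
have Sax : S (a *: x) by exact: subspaceZ.
by rewrite -[LHS]opprK -qN// -scaleNr qZ ?oppr_ge0 ?ltW// mulNr opprK.
Qed.

(** The directional derivative at [x0] is sublinear and at most the increment [p (x0 + x) - p x0],
    so any linear functional below it is a subgradient. *)
Theorem convex_subgradient S p x0 : subspace_set S -> convex_on S p -> S x0 ->
  exists2 L, linear_on S L & forall x, S x -> p x0 + L x <= p (x0 + x).
Proof.
move=> Ss pc S0.
(* [inf E] is the one-sided directional derivative of [p] at [x0]. *)
pose E x := [set (p (x0 + t *: x) - p x0) / t | t in [set t : R | 0 < t]].
have E0 x : E x !=set0 by exists ((p (x0 + 1 *: x) - p x0) / 1), 1 => /=.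
have Selt x t : S x -> S (x0 + t *: x).
  by move=> Sx; apply: subspaceD => //; exact: subspaceZ.
(* With weights [t / (s + t)] and [s / (s + t)], the points [x0 + s *: x] and [x0 + t *: y] average
   to a step of length [s * t / (s + t)] along [x + y]. *)
have slope x y (s t : R) : 0 < s -> 0 < t -> S x -> S y ->
    (p (x0 + (s * t / (s + t)) *: (x + y)) - p x0) / (s * t / (s + t)) <=
    (p (x0 + s *: x) - p x0) / s + (p (x0 + t *: y) - p x0) / t.
  move=> s0 t0 Sx Sy; have st : 0 < s + t by rewrite addr_gt0.
  have c0 : 0 <= t / (s + t) by rewrite divr_ge0 ?ltW.
  have c1 : t / (s + t) <= 1 by rewrite ler_pdivrMr// mul1r lerDr ltW.
  have := pc (t / (s + t)) _ _ c0 c1 (Selt _ s Sx) (Selt _ t Sy).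
  have -> : (t / (s + t)) *: (x0 + s *: x) +
      (1 - t / (s + t)) *: (x0 + t *: y) = x0 + (s * t / (s + t)) *: (x + y).
    have -> : 1 - t / (s + t) = s / (s + t) by field; rewrite gt_eqF.
    rewrite !scalerDr !scalerA addrACA -scalerDl.
    have -> : t / (s + t) + s / (s + t) = 1 by field; rewrite gt_eqF.
    rewrite scale1r; congr (_ + (_ *: _ + _ *: _)); field; rewrite gt_eqF//.
  rewrite ler_pdivrMr ?divr_gt0 ?mulr_gt0//.
  set A := p _; set B := p (x0 + _); set C := p (x0 + _); set D := p x0.
  move=> h; rewrite lerBlDr; apply: le_trans h _.
  rewrite le_eqVlt; apply/orP; left.
  by apply/eqP; field; rewrite !gt_eqF.
have Elb x : S x -> has_lbound (E x).
  (* In [slope] with directions [x] and [- x] the left side vanishes, so the unit quotient along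
     [- x] bounds those along [x]. *)
  move=> Sx; exists (- ((p (x0 + 1 *: - x) - p x0) / 1)) => _ [t /= t0 <-].
  have := slope x (- x) t 1 t0 ltr01 Sx (subspaceN Ss Sx).
  rewrite subrr scaler0 addr0 subrr mul0r; lra.
have ginf x t : S x -> 0 < t -> inf (E x) <= (p (x0 + t *: x) - p x0) / t.
  by move=> Sx t0; apply: ge_inf; [exact: Elb|exists t].
have Es : sublinear_on S (fun x => inf (E x)).
  split.
    move=> x y Sx Sy; apply: le_inf_add => // _ _ [s /= s0 <-] [t /= t0 <-].
    apply: le_trans (slope _ _ _ _ s0 t0 Sx Sy).
    by apply: ginf; [exact: subspaceD|rewrite divr_gt0 ?mulr_gt0 ?addr_gt0].
  move=> t x t0 Sx; apply: le_inf_mul => // _ [s /= s0 <-].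
  apply: le_trans (ginf _ (s / t) (subspaceZ t Ss Sx) (divr_gt0 s0 t0)) _.
  by rewrite scalerA divfK ?gt_eqF// invf_div mulrCA.
have [L Ll Lp] := hahn_banach Ss Es.
exists L => // x Sx; have := le_trans (Lp _ Sx) (ginf x 1 Sx ltr01).
by rewrite scale1r divr1 lerBrDl.
Qed.

End HahnBanach.

(** * Riesz-Markov on a compact metric space *)

Section CompactContinuous.
Context {R : realType} {X : pmetricType R}.
Implicit Types f g : X -> R.

Lemma ctsD f g : continuous f -> continuous g ->
  continuous (fun x => f x + g x).
Proof. by move=> cf cg x; apply: cvgD; [exact: cf|exact: cg]. Qed.

Lemma ctsB f g : continuous f -> continuous g ->
  continuous (fun x => f x - g x).
Proof. by move=> cf cg x; apply: cvgB; [exact: cf|exact: cg]. Qed.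

Lemma ctsM f g : continuous f -> continuous g ->
  continuous (fun x => f x * g x).
Proof. by move=> cf cg x; apply: cvgM; [exact: cf|exact: cg]. Qed.

Lemma cts_cst (c : R) : continuous (fun _ : X => c).
Proof. by move=> x; exact: cvg_cst. Qed.

Lemma cts_min f g : continuous f -> continuous g ->
  continuous (fun x => Num.min (f x) (g x)).
Proof.
by move=> cf cg x; apply: (@continuous_min R X); [exact: cf|exact: cg].
Qed.

Lemma cts_sum (F : nat -> X -> R) n : (forall i, continuous (F i)) ->
  continuous (fun x => \sum_(i < n) F i x).
Proof.
move=> cF; elim: n => [|n ih].
  by under eq_fun do rewrite big_ord0; exact: cts_cst.
by under eq_fun do rewrite big_ord_recr; exact: ctsD.
Qed.

Lemma cts_bounded f : compact [set: X] -> continuous f ->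
  exists2 M, 0 <= M & forall x, `|f x| <= M.
Proof.
move=> cptX cf.
have /compact_bounded[M [_ MP]] : compact (f @` [set: X]).
  by apply: continuous_compact => //; exact: continuous_subspaceT.
exists (`|M| + 1); first by rewrite addr_ge0.
by move=> x; apply: MP; [rewrite (le_lt_trans (ler_norm M))// ltrDl|exists x].
Qed.

Lemma subspace_continuous : subspace_set [set f : X -> R | continuous f].
Proof.
split; first exact: cts_cst.
by move=> a f g cf cg; apply: ctsD => //; apply: ctsM => //; exact: cts_cst.
Qed.

Lemma continuous_borel_measurable f : continuous f ->
  measurable_fun [set: borel X] (f : borel X -> R).
Proof.
move=> cf.
apply: (measurability _ (measurable_realfun.RGenOpens.measurableE R)).
move=> _ [_ [a [b ->] <-]]; rewrite setTI; apply: sub_sigma_algebra.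
by move/continuousP : cf; apply; exact: interval_open.
Qed.

(** The function is the distance to the complement of [U], truncated at [1]; the added value [1]
    also keeps the infimum over a nonempty set when [U] is the whole space. *)
Lemma open_support (U : set X) : open U ->
  exists f, [/\ continuous f, forall x, 0 <= f x & U = [set x | 0 < f x]].
Proof.
move=> oU; pose E x := [set mdist x y | y in ~` U] `|` [set 1 : R].
have E0 x : E x !=set0 by exists 1; right.
have Elb x : lbound (E x) 0.
  by move=> _ [[y _ <-]|->]; [exact: mdist_ge0|exact: ler01].
have Ehlb x : has_lbound (E x) by exists 0.
exists (fun x => inf (E x)); split.
- have lip x y : inf (E x) - mdist x y <= inf (E y).
    apply: lb_le_inf => // _ [[z Uz <-]|->].
      rewrite lerBlDr; apply: le_trans (_ : mdist x z <= _).
        by apply: ge_inf => //; left; exists z.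
      by rewrite addrC metric_triangle.
    rewrite lerBlDr ler_wpDr ?mdist_ge0//.
    by apply: ge_inf => //; right.
  move=> x; apply/cvgrPdist_lt => e e0; near=> y.
  have xy : mdist x y < e.
    have : ball x e y by near: y; exact: nbhsx_ballx.
    by rewrite ballEmdist.
  have := lip x y; have := lip y x; rewrite metric_sym => h1 h2.
  by rewrite ltr_norml; lra.
- by move=> x; exact: lb_le_inf.
- apply/seteqP; split => x /=.
    move=> Ux; have /nbhs_ballP[e /= e0 xU] : nbhs x U by exact: open_nbhs_nbhs.
    apply: (@lt_le_trans _ _ (Num.min e 1)); first by rewrite lt_min e0 ltr01.
    apply: lb_le_inf => // _ [[y Uy <-]|->]; last by rewrite ge_min lexx orbT.
    rewrite ge_min leNgt; apply/orP; left; apply/negP => xy.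
    by apply: Uy; apply: xU; rewrite ballEmdist.
  apply: contraPP => Ux; apply/negP; rewrite -leNgt.
  by apply: ge_inf => //; left; exists x => //; rewrite mdistxx.
Unshelve. all: by end_near. Qed.

End CompactContinuous.

(** * The measure representing a positive normalised functional *)

Section RieszContent.
Context {R : realType} {X : pmetricType R}.
Variable L : (X -> R) -> R.
Hypothesis Llin : linear_on [set f | continuous f] L.
Hypothesis Lpos : forall f : X -> R, continuous f ->
  (forall x, 0 <= f x) -> 0 <= L f.
Hypothesis L1 : L (fun=> 1) = 1.

Let LD (f g : X -> R) : continuous f -> continuous g ->
  L (fun x => f x + g x) = L f + L g.
Proof.
move=> cf cg; rewrite -[X in X + _]mul1r -Llin//; congr L.
by apply/funext => x; rewrite /= scale1r.
Qed.

Let L0 : L (fun=> 0) = 0.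
Proof.
have := LD (@cts_cst R X 0) (@cts_cst R X 0).
by under eq_fun do rewrite addr0; lra.
Qed.

Let LZ a (f : X -> R) : continuous f -> L (fun x => a * f x) = a * L f.
Proof.
move=> cf; have := Llin a cf (@cts_cst R X 0); rewrite L0 [RHS]addr0 => <-.
by congr L; apply/funext => x; rewrite /= addr0.
Qed.

Let LB (f g : X -> R) : continuous f -> continuous g ->
  L (fun x => f x - g x) = L f - L g.
Proof.
move=> cf cg; have /LD := ctsB cf cg.
by move=> /(_ g cg); under eq_fun do rewrite subrK; move=> ->; rewrite addrK.
Qed.

Let Lmono (f g : X -> R) : continuous f -> continuous g ->
  (forall x, f x <= g x) -> L f <= L g.
Proof.
move=> cf cg fg; rewrite -subr_ge0 -LB//; apply: Lpos; first exact: ctsB.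
by move=> x; rewrite subr_ge0.
Qed.

Let Lcst c : L (fun=> c) = c.
Proof.
rewrite -[RHS]mulr1 -L1 -LZ; last exact: cts_cst.
by congr L; apply/funext => x; rewrite mulr1.
Qed.

Let Lsum (F : nat -> X -> R) n : (forall i, continuous (F i)) ->
  L (fun x => \sum_(i < n) F i x) = \sum_(i < n) L (F i).
Proof.
move=> cF; elim: n => [|n ih].
  by under eq_fun do rewrite big_ord0; rewrite big_ord0.
under eq_fun do rewrite big_ord_recr; rewrite big_ord_recr /= -ih LD//.
exact: cts_sum.
Qed.

(* [c] bounds the integral of a function that dominates the indicator of [A] and
   is an increasing limit of continuous functions; requiring the value [1] to be
   reached, not only approached, does not change the infimum of such [c]. *)
Definition covered (A : set X) (c : R) := exists g : nat -> X -> R,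
  [/\ forall n, continuous (g n), forall n x, 0 <= g n x,
      {homo g : m n / (m <= n)%N >-> forall x, m x <= n x},
      forall n, L (g n) <= c & forall x, A x -> exists n, 1 <= g n x].

Definition riesz_content (A : set X) : R := inf [set c | covered A c].

(** Together with [covered_ge0], this makes [riesz_content] an infimum over a nonempty set bounded
    below, so the default value of [inf] never occurs. *)
Lemma covered1 A : covered A 1.
Proof.
exists (fun _ _ => 1); split => //.
- by move=> n; exact: cts_cst.
- by move=> n; rewrite L1.
- by move=> x _; exists 0%N.
Qed.

Lemma covered_ge0 A c : covered A c -> 0 <= c.
Proof. by move=> [g [cg g0 _ /(_ 0%N)]] + _; apply: le_trans; exact: Lpos. Qed.

Lemma covered_lbound A : has_lbound [set c | covered A c].
Proof. by exists 0 => c; exact: covered_ge0. Qed.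

Lemma covered_neq0 A : [set c | covered A c] !=set0.
Proof. by exists 1; exact: covered1. Qed.

Lemma riesz_content_le A c : covered A c -> riesz_content A <= c.
Proof. by move=> Ac; apply: ge_inf => //; exact: covered_lbound. Qed.

Lemma le_riesz_content A a : (forall c, covered A c -> a <= c) ->
  a <= riesz_content A.
Proof. by move=> h; apply: lb_le_inf => //; exact: covered_neq0. Qed.

Lemma riesz_content_ge0 A : 0 <= riesz_content A.
Proof. by apply: le_riesz_content => c; exact: covered_ge0. Qed.

Lemma riesz_content_mono A B : A `<=` B -> riesz_content A <= riesz_content B.
Proof.
move=> AB; apply: le_riesz_content => c [g [cg g0 gS Lg Bg]].
by apply: riesz_content_le; exists g; split => // x /AB; exact: Bg.
Qed.

Lemma riesz_content0 : riesz_content set0 = 0.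
Proof.
apply/eqP; rewrite eq_le riesz_content_ge0 andbT; apply: riesz_content_le.
exists (fun _ _ => 0); split => //.
- by move=> n; exact: cts_cst.
- by move=> n; rewrite L0.
Qed.

(** The [n]-th function is the sum of the [n]-th approximations for the first [n] sets. At a point
    of [A k] it reaches [1] once [n] exceeds [k] and the stage where [g k] does. *)
Lemma covered_bigcup (A : nat -> set X) (c : nat -> R) a :
  (forall n, covered (A n) (c n)) -> (forall n, \sum_(i < n) c i <= a) ->
  covered (\bigcup_n A n) a.
Proof.
move=> /choice[g gP] ca; exists (fun n x => \sum_(i < n) g i n x).
have cg i n : continuous (g i n) by have [] := gP i.
have g0 i n x : 0 <= g i n x by have [] := gP i.
have gS i m n x : (m <= n)%N -> g i m x <= g i n x.
  by have [_ _ gS _ _] := gP i; move=> mn; exact: gS.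
split => //.
- by move=> n; exact: (cts_sum (F := fun i => g i n)).
- by move=> n x; exact: sumr_ge0.
- move=> m n mn x; rewrite -(subnKC mn) big_split_ord/=.
  rewrite ler_wpDr ?sumr_ge0//; apply: ler_sum => i _.
  by apply: gS; exact: leq_addr.
- move=> n; rewrite (Lsum (F := fun i => g i n))//; apply: le_trans (ca n).
  by apply: ler_sum => i _; have [_ _ _ + _] := gP i; exact.
- move=> x [k _ Akx]; have [_ _ _ _ /(_ _ Akx)[n gn]] := gP k.
  exists (maxn k.+1 n).
  have kn : (k < maxn k.+1 n)%N by rewrite leq_max ltnSn.
  rewrite (bigD1 (Ordinal kn))//= ler_wpDr ?sumr_ge0//.
  by apply: le_trans gn _; apply: gS; exact: leq_maxr.
Qed.

Definition riesz_outer (A : set X) : \bar R := (riesz_content A)%:E.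

(** Each [A n] has a cover within [e / 2 ^ n.+1] of its content, and [covered_bigcup] adds these
    covers up. *)
Lemma riesz_outer_sigma_subadditive : sigma_subadditive riesz_outer.
Proof.
move=> A; apply/lee_addgt0Pr => e e0.
have r0 n : (0 <= riesz_outer (A n))%E by rewrite lee_fin riesz_content_ge0.
apply: le_trans (epsilon_trick xpredT r0 (ltW e0)).
have eps0 n : 0 < e / (2 ^ n.+1)%:R by rewrite divr_gt0// ltr0n expn_gt0.
have /choice[c cP] n :
    exists c, covered (A n) c /\ c < riesz_content (A n) + e / (2 ^ n.+1)%:R.
  by have [c Ac cn] := inf_adherent (eps0 n) (conj (covered_neq0 (A n))
    (covered_lbound (A n))); exists c.
case S : (\sum_(i <oo) _)%E => [s| |]; last 2 first.
- by rewrite leey.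
- have : (0 <= \sum_(i <oo) (riesz_outer (A i) + (e / (2 ^ i.+1)%:R)%:E))%E.
    by apply: nneseries_ge0 => i _ _; rewrite adde_ge0// lee_fin ltW.
  by rewrite S.
rewrite lee_fin; apply: riesz_content_le.
apply: covered_bigcup (fun n => (cP n).1) _ => n.
rewrite -lee_fin -S -sumEFin.
apply: le_trans (_ : (\sum_(i < n) (riesz_outer (A i) +
  (e / (2 ^ i.+1)%:R)%:E) <= _)%E).
  by apply: lee_sum => i _; rewrite -EFinD lee_fin ltW// (cP i).2.
rewrite -(big_mkord xpredT
  (fun i => riesz_outer (A i) + (e / (2 ^ i.+1)%:R)%:E)%E).
by apply: nneseries_lim_ge => i _ _; rewrite adde_ge0// lee_fin ltW.
Qed.

HB.instance Definition _ := isOuterMeasure.Build R X riesz_outer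
  (congr1 EFin riesz_content0)
  (fun A => riesz_content_ge0 A)
  (fun A B AB => riesz_content_mono AB)
  riesz_outer_sigma_subadditive.

Lemma riesz_caratheodory_open (U : set X) : open U ->
  riesz_outer.-caratheodory U.
Proof.
move=> /open_support[f [cf f0 UE]].
apply: le_caratheodory_measurable => E; rewrite -EFinD lee_fin.
apply: le_riesz_content => c [g [cg g0 gS Lg Eg]].
(* [psi m] increases to the indicator of [U]: [g n * psi n] covers [E `&` U]
   while [g n * (1 - psi m)] covers [E `&` ~` U], for each fixed [m]. *)
pose psi m x := Num.min 1 (m%:R * f x).
have cpsi m : continuous (psi m).
  apply: cts_min; first exact: cts_cst.
  by apply: ctsM => //; exact: cts_cst.
have psi0 m x : 0 <= psi m x by rewrite le_min ler01 mulr_ge0.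
have psi1 m x : psi m x <= 1 by rewrite ge_min lexx.
have psiS m n x : (m <= n)%N -> psi m x <= psi n x.
  move=> mn; rewrite le_min psi1 ge_min; apply/orP; right.
  by rewrite ler_wpM2r// ler_nat.
have cgpsi m n : continuous (fun x => g n x * psi m x) by exact: ctsM.
(* Starting the cover of the outer piece at index [m] gives [g m <= g (maxn n m)], so what [psi m]
   removes costs at least [L (g m * psi m)]. *)
have cut m : L (fun x => g m x * psi m x) <= c - riesz_content (E `&` ~` U).
  rewrite lerBrDr -lerBrDl; apply: riesz_content_le.
  exists (fun n x => g (maxn n m) x * (1 - psi m x)); split.
  - by move=> n; apply: ctsM => //; apply: ctsB => //; exact: cts_cst.
  - by move=> n x; rewrite mulr_ge0// subr_ge0.
  - move=> n n' nn' x; rewrite ler_wpM2r ?subr_ge0//; apply: gS.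
    by rewrite geq_max leq_maxr leq_max nn'.
  - move=> n.
    have -> : (fun x => g (maxn n m) x * (1 - psi m x)) =
        (fun x => g (maxn n m) x - g (maxn n m) x * psi m x).
      by apply/funext => x; rewrite mulrBr mulr1.
    rewrite LB// lerD//; rewrite lerN2; apply: Lmono => // x.
    by rewrite ler_wpM2r//; apply: gS; exact: leq_maxr.
  - move=> x [Ex Ux]; have [n gn] := Eg _ Ex; exists n.
    have -> : psi m x = 0.
      have fx : f x = 0.
        apply/eqP; rewrite eq_le f0 andbT leNgt; apply/negP => fx.
        by apply: Ux; rewrite UE.
      by rewrite /psi fx mulr0; apply/min_idPr.
    rewrite subr0 mulr1; apply: le_trans gn _; apply: gS; exact: leq_maxl.
rewrite -lerBrDr; apply: riesz_content_le.
exists (fun n x => g n x * psi n x); split => //.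
- by move=> n x; rewrite mulr_ge0.
- by move=> m n mn x; apply: ler_pM => //; [exact: gS|exact: psiS].
- move=> x [Ex]; rewrite UE /= => fx; have [n gn] := Eg _ Ex.
  (* As [k.+1] exceeds [1 / f x], the cut-off equals [1] at [x] from that index on. *)
  pose k := Num.trunc (f x)^-1; exists (maxn n k.+1).
  have -> : psi (maxn n k.+1) x = 1.
    apply/min_idPl; rewrite -ler_pdivrMr// mul1r.
    apply: (@le_trans _ _ k.+1%:R); first by rewrite ltW// truncnS_gt.
    by rewrite ler_nat leq_maxr.
  by rewrite mulr1; apply: le_trans gn _; apply: gS; exact: leq_maxl.
Qed.

(* Dini: on a compact space the increasing sequence of continuous functions
   [g n] overtakes [f - e] uniformly. *)
Lemma riesz_content_ge (A : set X) (f : X -> R) :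
  compact [set: X] -> continuous f ->
  (forall x, f x <= 1) -> (forall x, ~ A x -> f x <= 0) ->
  L f <= riesz_content A.
Proof.
move=> cptX cf f1 fA; apply: le_riesz_content => c [g [cg g0 gS Lg Ag]].
apply/ler_addgt0Pl => e e0.
have [N _ gN] : \forall n \near \oo, [set: X] `<=` [set x | f x - e < g n x].
  have /compact_near_coveringP := cptX; apply => x _ /=.
  have [n gn] : exists n, f x - e < g n x.
    have [Ax|Ax] := pselect (A x).
      by have [n gn] := Ag _ Ax; exists n; have := f1 x; lra.
    by exists 0%N; have := fA _ Ax; have := g0 0%N x; lra.
  have : \forall y \near x, 0 < (fun y => g n y - (f y - e)) y.
    have ch : continuous (fun y => g n y - (f y - e)).
      by apply: ctsB => //; apply: ctsB => //; exact: cts_cst.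
    by apply: (cvgr_gt _ (ch x)); rewrite subr_gt0.
  move=> h; near=> y m => /=; apply: lt_le_trans (_ : g n y <= _).
    by rewrite -subr_gt0; near: y.
  apply: gS; near: m; exact: nbhs_infty_ge.
rewrite -lerBlDl; apply: le_trans (Lg N).
have ce : continuous (fun _ : X => e) by exact: cts_cst.
rewrite -[X in _ - X]Lcst -LB//; apply: Lmono => //; first exact: ctsB.
by move=> x; apply: ltW; apply: gN => /=.
Unshelve. all: by end_near. Qed.

Lemma riesz_content_setT : compact [set: X] -> riesz_content setT = 1.
Proof.
move=> cptX; apply/eqP; rewrite eq_le riesz_content_le/=; last exact: covered1.
rewrite -[leLHS]L1; apply: riesz_content_ge => //; first exact: cts_cst.
by move=> x /(_ I).
Qed.

Hypothesis cptX : compact [set: X].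

(** The same set function on the type that carries the Borel sigma-algebra, so that measure
    structures can be attached to it. *)
Definition riesz_measure (A : set (borel X)) : \bar R := riesz_outer A.

Lemma borel_caratheodory (A : set (borel X)) : measurable A ->
  (riesz_outer : set X -> \bar R).-cara.-measurable A.
Proof.
apply: smallest_sub; first exact: sigma_algebra_measurable.
by move=> U oU; exact: riesz_caratheodory_open.
Qed.

Lemma riesz_measure_sigma_additive : semi_sigma_additive riesz_measure.
Proof.
move=> A mA tA mUA.
apply: (@caratheodory_measure_sigma_additive R X riesz_outer) => //.
- by move=> n; exact: borel_caratheodory.
- exact: borel_caratheodory.
Qed.

HB.instance Definition _ := isMeasure.Build _ (borel X) R riesz_measure
  (congr1 EFin riesz_content0) (fun A => riesz_content_ge0 A)
  riesz_measure_sigma_additive.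

HB.instance Definition _ := Measure_isProbability.Build _ (borel X) R
  riesz_measure (congr1 EFin (riesz_content_setT cptX)).

Lemma continuous_integrable (mu : borel_probability X) (f : X -> R) :
  continuous f -> mu.-integrable [set: borel X] (EFin \o f).
Proof.
move=> cf; apply: measurable_bounded_integrable => //.
- by have : (mu setT < +oo)%E by rewrite probability_setT ltry.
- exact: continuous_borel_measurable.
- have [M M0 fM] := cts_bounded cptX cf.
  exists M; split; first exact: num_real.
  by move=> N MN x _; apply: le_trans (fM x) (ltW MN).
Qed.

(* Layer-cake by induction on [n], splitting [f] as [min f e + (f - e)^+]; the
   error term telescopes because [e * mu (f > e)] is at most the integral of
   [min f e]. *)
Lemma riesz_le_integral_step (e : R) n (f : X -> R) : 0 < e -> continuous f ->
  (forall x, 0 <= f x) -> (forall x, f x <= n%:R * e) ->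
  L f <= \int[riesz_measure]_x f x + e * riesz_content [set x | 0 < f x].
Proof.
move=> e0; elim: n f => [|n ih] f cf f0 fe.
  have -> : f = fun=> 0.
    by apply/funext => x; apply/eqP; rewrite eq_le f0 -(mul0r e) fe.
  rewrite L0 addr_ge0//; last by rewrite mulr_ge0 ?riesz_content_ge0 ?ltW.
  exact: Rintegral_ge0.
pose g x := Num.min (f x) e; pose h x := f x - g x.
have cg : continuous g by apply: cts_min => //; exact: cts_cst.
have ch : continuous h by exact: ctsB.
have fE : f = fun x => h x + g x by apply/funext => x; rewrite subrK.
have h0 x : 0 <= h x by rewrite subr_ge0 ge_min lexx.
have hn x : h x <= n%:R * e.
  rewrite lerBlDr /g; have := fe x; rewrite -natr1 mulrDl mul1r => fen.
  rewrite minEle; case: ifP => _; last exact: fen.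
  by rewrite lerDr mulr_ge0// ltW.
(* The function [g / e] is at most [1] and vanishes where [f] does, so its value under [L] is at
   most the content of the support. *)
have Lg : L g <= e * riesz_content [set x | 0 < f x].
  have -> : L g = e * L (fun x => e^-1 * g x).
    by rewrite LZ// mulrA divff ?gt_eqF// mul1r.
  rewrite ler_pM2l//; apply: riesz_content_ge => //.
  - by apply: ctsM => //; exact: cts_cst.
  - by move=> x; rewrite mulrC ler_pdivrMr// mul1r ge_min lexx orbT.
  - move=> x /negP; rewrite -leNgt => fx.
    by rewrite mulr_ge0_le0 ?invr_ge0 ?(ltW e0)// ge_min fx.
(* Markov's inequality: [h > 0] means [f > e], and there [g = e]. This absorbs the error term of the
   induction hypothesis for [h]. *)
have hsupp : e * riesz_content [set x | 0 < h x] <= \int[riesz_measure]_x g x.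
  have oh : @measurable _ (borel X) [set x | 0 < h x].
    apply: sub_sigma_algebra.
    by apply: (@open_comp _ _ h [set r | 0 < r]) => // x _; exact: ch.
  have -> : e * riesz_content [set x | 0 < h x] =
      \int[riesz_measure]_(x in [set x | 0 < h x]) e by rewrite Rintegral_cst.
  rewrite Rintegral_mkcond.
  apply: le_Rintegral => //.
  - rewrite -restrict_EFin; apply/(integrable_mkcond _ oh).
    exact: finite_measure_integrable_cst.
  - exact: continuous_integrable.
  - move=> x _; rewrite patchE; case: ifPn => [|_].
      rewrite inE /= /h subr_gt0 gt_min ltxx /= => ef.
      by rewrite /g (min_idPr (ltW ef)).
    by rewrite le_min f0 ltW.
have Lf : L f = L h + L g by rewrite [in LHS]fE LD.
have intf : \int[riesz_measure]_x f x =
    \int[riesz_measure]_x h x + \int[riesz_measure]_x g x.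
  by rewrite [in LHS]fE RintegralD//; exact: continuous_integrable.
rewrite Lf intf; apply: le_trans (lerD (ih h ch h0 hn) Lg) _.
by rewrite lerD2r lerD2l.
Qed.

(** Adding a bound [M] makes the function nonnegative. Finitely many layers of height [e] then reach
    [2 M], with total error at most [e] because contents are at most [1]. *)
Lemma riesz_le_integral (f : X -> R) : continuous f ->
  L f <= \int[riesz_measure]_x f x.
Proof.
move=> cf; have [M M0 fM] := cts_bounded cptX cf.
have cM : continuous (fun _ : X => M) by exact: cts_cst.
have cfM : continuous (fun x => f x + M) by exact: ctsD.
suff : L (fun x => f x + M) <= \int[riesz_measure]_x (f x + M).
  rewrite LD// Lcst RintegralD//; try exact: continuous_integrable.
  rewrite Rintegral_cst// [fine _](_ : _ = 1) ?mulr1 ?lerD2r//.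
  exact: (congr1 fine (congr1 EFin (riesz_content_setT cptX))).
have bd x : 0 <= f x + M <= M *+ 2.
  by have := fM x; rewrite ler_norml => /andP[]; rewrite mulr2n; lra.
apply/ler_addgt0Pr => e e0; pose n := (Num.trunc (M *+ 2 / e)).+1.
have fn x : f x + M <= n%:R * e.
  rewrite -ler_pdivrMr//; apply: le_trans (ltW (truncnS_gt _)).
  by rewrite ler_pM2r ?invr_gt0//; have /andP[] := bd x.
have f0 x : 0 <= f x + M by have /andP[] := bd x.
apply: le_trans (riesz_le_integral_step e0 cfM f0 fn) _.
rewrite lerD2l -[leRHS]mulr1 ler_pM2l//; apply: riesz_content_le.
exact: covered1.
Qed.

(** The inequality [riesz_le_integral] for [- f] is the reverse inequality for [f]. *)
Theorem riesz_markov :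
  exists mu : borel_probability X, forall f : X -> R, continuous f ->
    \int[mu]_x f x = L f.
Proof.
exists (riesz_measure : borel_probability X) => f cf.
apply/eqP; rewrite eq_le riesz_le_integral// andbT.
have cN : continuous (fun x => -1 * f x) by apply: ctsM => //; exact: cts_cst.
have := riesz_le_integral cN; rewrite LZ// RintegralZl//.
  by rewrite !mulN1r lerN2.
exact: continuous_integrable.
Qed.

End RieszContent.

(** * Topological pressure as a convex function of the potential *)

Section ExponentialGrowth.
Context {R : realType}.
Variable F : R -> nat -> \bar R.
Local Open Scope ereal_scope.

Hypothesis F_ge0 : forall e n, 0 <= F e n.
Hypothesis F_nincr : forall e e' n, (0 < e)%R -> (e <= e')%R -> F e' n <= F e n.

(** Common form of [Ptop] and [htop], with [F] equal to [pressure_n f phi] and [max_separated f]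
    respectively. *)
Definition growth_rate :=
  lim (limn_esup (fun n => (n%:R^-1)%:E * lne (F e n)) @[e --> (0%R : R)^'+]).

Lemma rate_le_expR e n a : (0 < n)%N ->
  ((n%:R^-1)%:E * lne (F e n) <= a%:E) = (F e n <= (expR (n%:R * a))%:E).
Proof.
move=> n0; rewrite lee_pdivrMl ?ltr0n// -EFinM -[LHS]lee_expeR.
by have /eqP -> : expeR (lne (F e n)) == F e n by rewrite lneK_eq.
Qed.

(** [F] grows as [e] decreases, so the limit from the right is a supremum. *)
Lemma growth_rateE : growth_rate =
  ereal_sup [set limn_esup (fun n => (n%:R^-1)%:E * lne (F e n))
            | e in [set e : R | (0 < e)%R]].
Proof.
have setE : [set` `]0%R, +oo[ ] = [set e : R | (0 < e)%R].
  by apply/seteqP; split => e /=; rewrite in_itv/= andbT.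
rewrite -setE; apply: cvg_lim => //; apply: nonincreasing_at_right_cvge => //.
move=> e e'; rewrite !in_itv/= !andbT => e0 e'0 ee'.
apply: le_ereal_inf_tmp => _ [V [m _ mV] <-].
(* The index [0] is cut off the tail because [n%:R^-1] must be positive to be cancelled. *)
apply: le_trans (ereal_inf_lbound _) _.
  exists (V `&` [set n | (0 < n)%N]) => //.
  by apply: filterI; [exists m|exists 1%N].
apply: ge_ereal_sup => _ [n [Vn /= n0] <-].
apply: ereal_sup_ge; exists ((n%:R^-1)%:E * lne (F e n)); first by exists n.
rewrite lee_pmul2l// ?lte_fin ?invr_gt0 ?ltr0n//.
by rewrite lee_lne ?F_nincr// in_itv/= leey F_ge0.
Qed.

Lemma growth_rate_le a :
  (forall e, (0 < e)%R ->
    \forall n \near \oo, F e n <= (expR (n%:R * a))%:E) ->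
  growth_rate <= a%:E.
Proof.
move=> Fa; rewrite growth_rateE; apply: ge_ereal_sup => _ [e /= e0 <-].
apply: le_trans (ereal_inf_lbound _) _.
  exists ([set n | F e n <= (expR (n%:R * a))%:E] `&` [set n | (0 < n)%N]);
    last by [].
  by apply: filterI; [exact: Fa|exists 1%N].
by apply: ge_ereal_sup => _ [n [/= Fn n0] <-]; rewrite rate_le_expR.
Qed.

(** Strictness leaves room: some tail has supremum below [a], which bounds all its terms. *)
Lemma growth_rate_lt a : growth_rate < a%:E ->
  forall e, (0 < e)%R -> \forall n \near \oo, F e n <= (expR (n%:R * a))%:E.
Proof.
rewrite growth_rateE => Fa e e0.
have /ereal_inf_lt[_ [V VF <-] Va] :
    limn_esup (fun n => (n%:R^-1)%:E * lne (F e n)) < a%:E.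
  by apply: le_lt_trans Fa; apply: ereal_sup_ubound; exists e.
near=> n; rewrite -rate_le_expR; last by near: n; exists 1%N.
apply: ltW; apply: le_lt_trans Va; apply: ereal_sup_ubound; exists n => //.
by near: n.
Unshelve. all: by end_near. Qed.

End ExponentialGrowth.

(** * Finiteness, convexity and tangent measures of the pressure *)

Section PressureProperties.
Context {R : realType} {X : pmetricType R}.
Variable f : nat -> X -> X.
Implicit Types phi psi : X -> R.

Lemma separated_anti n e e' (E : set X) : e <= e' ->
  Defs.separated f n e' E -> Defs.separated f n e E.
Proof.
by move=> ee' sE x y Ex Ey xy; exact: le_trans ee' (sE x y Ex Ey xy).
Qed.

Lemma pressure_n_ge0 phi e n : (0 <= pressure_n f phi e n)%E.
Proof. by apply: ereal_sup_ubound; exists set0 => //; rewrite esum_set0. Qed.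

Lemma pressure_n_nincr phi e e' n : 0 < e -> e <= e' ->
  (pressure_n f phi e' n <= pressure_n f phi e n)%E.
Proof.
move=> _ ee'; apply: ereal_sup_le => _ [E sE <-]; exists E => //.
exact: separated_anti sE.
Qed.

Lemma max_separated_ge0 e n : (0 <= max_separated f e n)%E.
Proof.
apply: ereal_sup_ubound; exists set0 => //.
by rewrite /counting asboolT// fset_set0.
Qed.

Lemma max_separated_nincr e e' n : 0 < e -> e <= e' ->
  (max_separated f e' n <= max_separated f e n)%E.
Proof.
move=> _ ee'; apply: ereal_sup_le => _ [E sE <-]; exists E => //.
exact: separated_anti sE.
Qed.

(** An [\esum] is a supremum of finite sums and subsets of separated sets are separated, so
    duplicate-free lists suffice. *)
Lemma pressure_n_le phi e n c :
  (pressure_n f phi e n <= c%:E)%E <->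
  (forall s : seq X, uniq s -> Defs.separated f n e [set` s] ->
    \sum_(x <- s) expR (birkhoff_sum f phi n x) <= c).
Proof.
split => [pc s us ss|sc].
  rewrite -lee_fin; apply: le_trans pc; apply: ereal_sup_ubound.
  exists [set` s] => //; rewrite esum_fset; last 2 first.
  - exact: finite_seq.
  - by move=> x _; rewrite lee_fin expR_ge0.
  rewrite fsumEFin; last exact: finite_seq.
  by rewrite -fsbig_seq.
apply: ge_ereal_sup => _ [E /= sE <-]; apply: ge_ereal_sup => _ [A [fA AE] <-].
rewrite fsumEFin// lee_fin fsbig_finite//=.
apply: sc; first exact: finmap.fset_uniq.
by move=> x y /=; rewrite !in_fset_set// !inE => Ax Ay; apply: sE; exact: AE.
Qed.

(** By [Ptop_le] and [Ptop_lt], [Ptop f phi] is the infimum of these [a]; the estimates below thus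
    concern finite real sums only. *)
Definition pressure_bound phi a := forall e, 0 < e -> \forall n \near \oo,
  forall s : seq X, uniq s -> Defs.separated f n e [set` s] ->
    \sum_(x <- s) expR (birkhoff_sum f phi n x) <= expR (n%:R * a).

Lemma Ptop_le phi a : pressure_bound phi a -> (Ptop f phi <= a%:E)%E.
Proof.
move=> Pa; apply: growth_rate_le => [e n|e e' n|e e0].
- exact: pressure_n_ge0.
- exact: pressure_n_nincr.
- by apply: filterS (Pa e e0) => n; move/pressure_n_le.
Qed.

Lemma Ptop_lt phi a : (Ptop f phi < a%:E)%E -> pressure_bound phi a.
Proof.
move=> Pa e e0.
have := growth_rate_lt (@pressure_n_ge0 phi) (@pressure_n_nincr phi) Pa e0.
by apply: filterS => n /pressure_n_le.
Qed.

(** For the zero potential every term is [expR 0 = 1], and the sum is a cardinality. *)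
Lemma htop_pressure_bound a : (htop f < a%:E)%E -> pressure_bound (fun=> 0) a.
Proof.
move=> ha e e0.
have := growth_rate_lt max_separated_ge0 max_separated_nincr ha e0.
apply: filterS => n hn s us ss; rewrite -lee_fin; apply: le_trans hn.
apply: ereal_sup_ubound; exists [set` s] => //.
have fs : finite_set [set` s] by exact: finite_seq.
rewrite /counting asboolT//; congr EFin.
have -> : size (finmap.enum_fset (fset_set [set` s])) = size s.
  apply: perm_size; apply: uniq_perm; [exact: finmap.fset_uniq|by []|].
  by move=> x; rewrite in_fset_set//; apply/idP/idP => [/set_mem|/mem_set].
rewrite (eq_bigr (fun=> 1)); last first.
  by move=> x _; rewrite /birkhoff_sum big1// expR0.
by rewrite big_const_seq count_predT iter_addr_0.
Qed.

Lemma pressure_bound_mono phi psi a : (forall x, phi x <= psi x) ->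
  pressure_bound psi a -> pressure_bound phi a.
Proof.
move=> pq Pa e e0; apply: filterS (Pa e e0) => n hn s us ss.
apply: le_trans (hn s us ss); apply: ler_sum => x _.
by rewrite ler_expR; apply: ler_sum => i _.
Qed.

Lemma pressure_boundD phi c a : pressure_bound phi a ->
  pressure_bound (fun x => phi x + c) (a + c).
Proof.
move=> Pa e e0; apply: filterS (Pa e e0) => n hn s us ss.
have -> : \sum_(x <- s) expR (birkhoff_sum f (fun x => phi x + c) n x) =
    (\sum_(x <- s) expR (birkhoff_sum f phi n x)) * expR (n%:R * c).
  rewrite mulr_suml; apply: eq_bigr => x _; rewrite -expRD; congr expR.
  by rewrite /birkhoff_sum big_split/= sumr_const_nat subn0 mulr_natl.
by rewrite mulrDr expRD ler_pM2r ?expR_gt0//; exact: hn.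
Qed.

(** The graph lies above its tangent line at the averaged point [w], and the linear terms cancel in
    the average. *)
Lemma expR_convex (t u v : R) : 0 <= t -> t <= 1 ->
  expR (t * u + (1 - t) * v) <= t * expR u + (1 - t) * expR v.
Proof.
move=> t0 t1; set w := t * u + _.
have h z : expR w * (1 + (z - w)) <= expR z.
  have -> : expR z = expR w * expR (z - w) by rewrite -expRD subrKC.
  by rewrite ler_pM2l ?expR_gt0// expR_ge1Dx.
have t'0 : 0 <= 1 - t by rewrite subr_ge0.
apply: le_trans (lerD (ler_wpM2l t0 (h u)) (ler_wpM2l t'0 (h v))).
by rewrite le_eqVlt; apply/orP; left; apply/eqP; rewrite /w; ring.
Qed.

(* Hoelder's inequality, after normalising both sums to be at most [1]. *)
Lemma pressure_bound_convex t phi psi a b : 0 <= t -> t <= 1 ->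
  pressure_bound phi a -> pressure_bound psi b ->
  pressure_bound (fun x => t * phi x + (1 - t) * psi x) (t * a + (1 - t) * b).
Proof.
move=> t0 t1 Pa Pb e e0; apply: filterS2 (Pa e e0) (Pb e e0) => n ha hb s us ss.
have {}ha := ha s us ss; have {}hb := hb s us ss.
set A := birkhoff_sum f phi n; set B := birkhoff_sum f psi n.
have SE x : birkhoff_sum f (fun x => t * phi x + (1 - t) * psi x) n x =
    n%:R * (t * a + (1 - t) * b) +
    (t * (A x - n%:R * a) + (1 - t) * (B x - n%:R * b)).
  by rewrite /birkhoff_sum big_split/= -!mulr_sumr -/(birkhoff_sum f phi n x)
    -/(birkhoff_sum f psi n x) /A /B; ring.
under eq_bigr do rewrite SE expRD.
rewrite -mulr_sumr -[leRHS]mulr1 ler_pM2l ?expR_gt0//.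
have norm (S : X -> R) c : \sum_(x <- s) expR (S x) <= expR (n%:R * c) ->
    \sum_(x <- s) expR (S x - n%:R * c) <= 1.
  move=> h; under eq_bigr do rewrite expRD expRN.
  by rewrite -mulr_suml ler_pdivrMr ?expR_gt0// mul1r.
(* Pointwise convexity of the exponential combines the two normalised sums with weights [t] and
   [1 - t]. *)
apply: (@le_trans _ _ (\sum_(x <- s) (t * expR (A x - n%:R * a) +
    (1 - t) * expR (B x - n%:R * b)))).
  by apply: ler_sum => x _; exact: expR_convex.
rewrite big_split/= -!mulr_sumr.
have t'0 : 0 <= 1 - t by rewrite subr_ge0.
apply: le_trans (lerD (ler_wpM2l t0 (norm _ _ ha))
  (ler_wpM2l t'0 (norm _ _ hb))) _.
by rewrite !mulr1 subrKC.
Qed.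

(** A singleton is separated at every scale, and its Birkhoff sum is at least [- n M]. *)
Lemma pressure_bound_ge phi a M : (forall x, - M <= phi x) ->
  pressure_bound phi a -> - M <= a.
Proof.
move=> phiM /(_ 1 ltr01)[m _ Pm].
have sep1 : Defs.separated f m.+1 1 [set` [:: (point : X)]].
  by move=> x y /=; rewrite !inE => /eqP -> /eqP ->; rewrite eqxx.
have := Pm m.+1 (leqnSn m) [:: point] ltac:(by []) sep1.
rewrite big_seq1 ler_expR => h.
have : m.+1%:R * - M <= m.+1%:R * a.
  apply: le_trans h; rewrite /birkhoff_sum.
  apply: (@le_trans _ _ (\sum_(0 <= i < m.+1) - M)).
    by rewrite sumr_const_nat subn0 mulr_natl.
  by apply: ler_sum => i _.
by rewrite ler_pM2l ?ltr0n.
Qed.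

Hypothesis hf : (htop f < +oo)%E.

(** Comparison with the constant [M] bounds the pressure above through the entropy; singletons rule
    out [-oo]. *)
Lemma Ptop_fin_num phi M : (forall x, `|phi x| <= M) ->
  Ptop f phi \is a fin_num.
Proof.
move=> phiM; have {phiM} bd x : - M <= phi x <= M by rewrite -ler_norml.
have phi_ge x : - M <= phi x by have /andP[] := bd x.
have phi_le x : phi x <= 0 + M by have /andP[_] := bd x; rewrite add0r.
have [a ha] : exists a : R, (htop f < a%:E)%E.
  case: (htop f) hf => [r _| //|_]; last by exists 0; rewrite ltNyr.
  by exists (r + 1); rewrite lte_fin ltrDl.
have upper := Ptop_le (pressure_bound_mono phi_le
  (pressure_boundD M (htop_pressure_bound ha))).
have := pressure_bound_ge phi_ge; have := @Ptop_lt phi.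
case: (Ptop f phi) upper => [r //| |_ lt_bd ge_bd]; first by rewrite leye_eq.
(* If the pressure were [-oo], then [- M - 1] would be a pressure bound, below the least possible
   one [- M]. *)
have := ge_bd _ (lt_bd (- M - 1) (ltNyr _)).
by rewrite leNgt ltrBlDr ltrDl ltr01.
Qed.

Hypothesis cptX : compact [set: X].

(** Real-valued, as subgradients require; [pressureE] shows that [fine] loses nothing on continuous
    potentials. *)
Definition pressure phi : R := fine (Ptop f phi).

Lemma pressureE phi : continuous phi -> Ptop f phi = (pressure phi)%:E.
Proof.
move=> cphi; have [M _ phiM] := cts_bounded cptX cphi.
by rewrite fineK//; exact: Ptop_fin_num phiM.
Qed.

Lemma pressure_le phi a : continuous phi -> pressure_bound phi a ->
  pressure phi <= a.
Proof. by move=> cphi /Ptop_le; rewrite pressureE// lee_fin. Qed.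

Lemma pressure_lt phi a : continuous phi -> pressure phi < a ->
  pressure_bound phi a.
Proof. by move=> cphi pa; apply: Ptop_lt; rewrite pressureE// lte_fin. Qed.

Lemma pressure_mono phi psi : continuous phi -> continuous psi ->
  (forall x, phi x <= psi x) -> pressure phi <= pressure psi.
Proof.
move=> cphi cpsi pq; apply/ler_addgt0Pr => e e0; apply: pressure_le => //.
by apply: pressure_bound_mono pq _; apply: pressure_lt; rewrite ?ltrDl.
Qed.

(** Used with [c = 1] and [c = -1], this one-sided bound already normalises a subgradient. *)
Lemma pressureD_le phi c : continuous phi ->
  pressure (fun x => phi x + c) <= pressure phi + c.
Proof.
move=> cphi; apply/ler_addgt0Pr => e e0; rewrite addrAC.
apply: pressure_le; first by apply: ctsD => //; exact: cts_cst.
by apply: pressure_boundD; apply: pressure_lt; rewrite ?ltrDl.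
Qed.

Lemma pressure_convex : convex_on [set phi : X -> R | continuous phi] pressure.
Proof.
move=> t phi psi t0 t1 cphi cpsi; apply/ler_addgt0Pr => e e0.
have cS : continuous (fun x => t * phi x + (1 - t) * psi x).
  by apply: ctsD; apply: ctsM => //; exact: cts_cst.
have shiftE p q : t * p + (1 - t) * q + e = t * (p + e) + (1 - t) * (q + e).
  by ring.
rewrite shiftE; apply: (pressure_le cS); apply: pressure_bound_convex => //;
  by apply: pressure_lt; rewrite ?ltrDl.
Qed.

Theorem pressure_tangent_measure phi : continuous phi ->
  exists mu : borel_probability X, forall psi, continuous psi ->
    pressure phi - \int[mu]_x phi x <= pressure psi - \int[mu]_x psi x.
Proof.
move=> cphi.
have [L Llin Lp] := convex_subgradient subspace_continuous pressure_convex cphi.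
have c0 : continuous (fun _ : X => 0 : R) by exact: cts_cst.
have cc c : continuous (fun _ : X => c : R) by exact: cts_cst.
have L0 : L (fun=> 0) = 0.
  have := Llin 1 _ _ c0 c0.
  by rewrite scale1r [X in L X]addr0 mul1r; lra.
have LN psi : continuous psi -> L (fun x => - psi x) = - L psi.
  move=> cpsi; have := Llin (-1) _ _ cpsi c0.
  by rewrite scaleN1r [X in L X]addr0 L0 [RHS]addr0 mulN1r.
have Lpos psi : continuous psi -> (forall x, 0 <= psi x) -> 0 <= L psi.
  move=> cpsi psi0.
  have cN : continuous (fun x => - psi x) by move=> x; apply: cvgN; exact: cpsi.
  (* Passing from [phi] to [phi - psi] does not raise the pressure, so [L (- psi) <= 0]. *)
  have := le_trans (Lp _ cN) (pressure_mono (ctsD cphi cN) cphi _).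
  by rewrite gerDl LN// oppr_le0; apply => x; rewrite gerDl oppr_le0.
have Lcst_le c : L (fun=> c) <= c.
  by have := le_trans (Lp _ (cc c)) (pressureD_le c cphi); rewrite lerD2l.
have L1 : L (fun=> 1) = 1.
  apply/eqP; rewrite eq_le Lcst_le/= -lerN2 -LN//; exact: Lcst_le.
have [mu muL] := riesz_markov Llin Lpos L1 cptX.
exists mu => psi cpsi; rewrite !muL//.
(* The support inequality is taken at the increment [psi - phi]. *)
have := Lp _ (ctsB cpsi cphi).
have -> : phi + (fun x => psi x - phi x) = psi.
  by apply/funext => x; rewrite /= addrC subrK.
have -> : (fun x => psi x - phi x) = 1 *: psi + (fun x => - phi x).
  by apply/funext => x; rewrite /= scale1r.
rewrite Llin//; last by move=> x; apply: cvgN; exact: cphi.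
have rearr (p q a b : R) : p + (1 * b - a) <= q -> p - a <= q - b by lra.
by rewrite LN//; exact: rearr.
Qed.

End PressureProperties.

(** * Weak-star continuity and the variational principle *)

Lemma weak_star_continuous {R : realType} (X : pmetricType R)
    (phi : continuousType X R) :
  continuous ((fun mu : borel_probability X => \int[mu]_x phi x) :
    weak_star X -> R).
Proof.
have proj_cont : continuous
    ((fun F => F phi) : {ptws continuousType X R -> R} -> R).
  exact: (@proj_continuous (continuousType X R) (fun=> R) phi).
pose pairing : weak_star X -> {ptws continuousType X R -> R} :=
  fun (mu : borel_probability X) psi => \int[mu]_x psi x.
have pairing_cont : continuous pairing by exact: initial_continuous.
move=> mu; exact: (continuous_comp (pairing_cont mu) (proj_cont (pairing mu))).
Qed.

Local Open Scope ereal_scope.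

Theorem theoremA (R : realType) (X : pmetricType R) (f : nat -> X -> X)
    (cptX : compact [set: X])
    (cf : forall n : nat, (1 <= n)%N -> continuous (f n))
    (hf : htop f < +oo) :
  exists h : borel_probability X -> \bar R,
    [/\ forall mu : borel_probability X, h mu < +oo,
        upper_semicontinuous (h : weak_star X -> \bar R),
        forall phi : continuousType X R,
          (exists mu : borel_probability X,
             Ptop f phi = h mu + (\int[mu]_x phi x)%R%:E) /\
          (forall mu : borel_probability X,
             h mu + (\int[mu]_x phi x)%R%:E <= Ptop f phi)
      & forall mu : borel_probability X,
          h mu = ereal_inf [set Ptop f phi - (\int[mu]_x phi x)%R%:E
                           | phi in [set: continuousType X R]]].
Proof.
have Pfin (phi : continuousType X R) : Ptop f phi = (pressure f phi)%:E.
  by apply: pressureE => //; exact: cts_fun.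
pose gap (mu : borel_probability X) (phi : continuousType X R) : \bar R :=
  Ptop f phi - (\int[mu]_x phi x)%R%:E.
have gapE mu phi : gap mu phi = (pressure f phi - \int[mu]_x phi x)%R%:E.
  by rewrite /gap Pfin EFinB.
pose h mu := ereal_inf [set gap mu phi | phi in [set: continuousType X R]].
have h_le mu phi : h mu <= gap mu phi by apply: ereal_inf_lbound; exists phi.
exists h; split => //.
- move=> mu; pose phi0 : continuousType X R := mkcts (@cts_cst R X 0%R).
  by apply: le_lt_trans (h_le mu phi0) _; rewrite gapE ltry.
(* A single potential [phi] witnesses [h mu < a], and by weak-star continuity it still does so near
   [mu]. *)
- move=> mu a /ereal_inf_lt[_ [phi _ <-]]; rewrite gapE lte_fin.
  rewrite ltrBlDr -ltrBlDl => lta.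
  exists [set nu : borel_probability X |
      (pressure f phi - a < \int[nu]_x phi x)%R].
    exact: (cvgr_gt _ (@weak_star_continuous R X phi mu) _ lta).
  move=> nu /= nua; apply: le_lt_trans (h_le nu phi) _.
  by rewrite gapE lte_fin ltrBlDr -ltrBlDl.
- move=> phi; split; last first.
    by move=> mu; rewrite -leeBrDr//; exact: h_le.
  (* For the tangent measure at [phi], the gap is smallest at [phi] itself, so the infimum [h mu] is
     attained there. *)
  have [mu mu_min] := pressure_tangent_measure hf cptX (@cts_fun _ _ phi).
  exists mu; suff -> : h mu = gap mu phi by rewrite /gap subeK.
  apply/eqP; rewrite eq_le h_le/=; apply: le_ereal_inf_tmp => _ [psi _ <-].
  by rewrite !gapE lee_fin; apply: mu_min; exact: cts_fun.
Qed.
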